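(* Let $n=2$ and $\lambda\ne0$. Up to an overall normalisation and periodic null modes in the coefficients, there is a 2-parameter family of central quantum-symmetric metrics of the form $$g=(t^2+2\beta t+\lambda t+\alpha)\,\mathrm dx\otimes \mathrm dx-x(t+\beta)(\mathrm dx\otimes \mathrm dt+\mathrm dt\otimes \mathrm dx)+x^2\,\mathrm dt\otimes \mathrm dt,$$ where $\alpha,\beta$ are parameters (constants). The degenerate cases are $$g_{deg}=(\alpha-2t)\,\mathrm dx\otimes \mathrm dx+x(\mathrm dx\otimes \mathrm dt+\mathrm dt\otimes \mathrm dx),\qquad g_{deg}=\mathrm dx\otimes \mathrm dx.$$ (Together these are all the central quantum-symmetric $g$, up to normalisation and periodic null modes; the degenerate cases are those with vanishing $\mathrm dt\otimes\mathrm dt$ coefficient.)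
   Context: $\lambda$ is an imaginary parameter. $A$ is the algebra with generators $x,t$ and relation $[x,t]=\lambda x$. A general element of $A$ is thought of as a normal-ordered function $f(x,t)$, with $t$ to the right. The class of functions is not specified further. The relation implies $$[f(x),t]=\lambda x f'(x),\qquad [h(t),x]=x\big(h(t-\lambda)-h(t)\big)$$ for functions $f$ of $x$ and $h$ of $t$. Periodic null modes are the nonconstant functions $h(t)$ with $h(t-\lambda)=h(t)$, such as $e^{2\pi \imath m t/\lambda}$ with $m$ a nonzero integer. They have no limit as $\lambda\to0$. ''Up to periodic null modes'' means that such modes are excluded from the coefficients of $g$, so that an element commuting with $x$ is taken to be a function of $x$ alone. (For example, there are no such modes if one limits oneself to rational functions of $t$.) $\Omega^1$ is the $A$-bimodule of 1-forms, with basis $\mathrm dx,\mathrm dt$ over $A$ and relations $$[\mathrm dx,x]=0,\quad [\mathrm dx,t]=0,\quad [x,\mathrm dt]=\lambda\,\mathrm dx,\quad [t,\mathrm dt]=\lambda\,\mathrm dt .$$ A metric here is an element $g=a\,\mathrm dx\otimes \mathrm dx+b(\mathrm dx\otimes \mathrm dt+\mathrm dt\otimes \mathrm dx)+c\,\mathrm dt\otimes \mathrm dt\in\Omega^1\otimes_A\Omega^1$ with $a,b,c\in A$. This form expresses quantum symmetry, $\wedge(g)=0$, where $\mathrm dx,\mathrm dt$ anticommute and square to zero in the exterior algebra. Central means commuting with all elements of $A$. *)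

(* Defs.v *)
From HB Require Import structures.
From mathcomp Require Import all_boot all_order all_algebra.
From mathcomp Require Import reals complex.

Set Implicit Arguments.
Unset Strict Implicit.
Unset Printing Implicit Defensive.
Import GRing.Theory.
Local Open Scope ring_scope.

(* A class of functions f(x,t) under pointwise operations: a commutative
   algebra closed under the partial derivatives and under the shift
   f(x,t) |-> f(x, t - lam).  Nothing else is imposed on the class; examples
   are polynomials in x with polynomial, rational or entire coefficients in t,
   Laurent polynomials in x with such coefficients, or polynomials in t with
   smooth coefficients in x.  Rational functions of t have poles, so the class
   is not embedded in the total functions on a fixed domain. *)
Record function_class (K : fieldType) (lam : K) := FunctionClass {
  fun_alg :> comAlgType K;
  fx : fun_alg;
  ft : fun_alg;
  ddx : {linear fun_alg -> fun_alg};
  ddt : {linear fun_alg -> fun_alg};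
  shift : {lrmorphism fun_alg -> fun_alg};
  ddx_mul : forall f g, ddx (f * g) = ddx f * g + f * ddx g;
  ddt_mul : forall f g, ddt (f * g) = ddt f * g + f * ddt g;
  ddx_x : ddx fx = 1;
  ddx_t : ddx ft = 0;
  ddt_x : ddt fx = 0;
  ddt_t : ddt ft = 1;
  ddxC : forall f, ddx (ddt f) = ddt (ddx f);
  shift_x : shift fx = fx;
  shift_t : shift ft = ft - lam%:A;
  shift_ddx : forall f, shift (ddx f) = ddx (shift f);
  shift_ddt : forall f, shift (ddt f) = ddt (shift f);
  fx_regular : forall f, fx * f = 0 -> f = 0
}.

Definition function_of_x (K : fieldType) (lam : K) (F : function_class lam)
    (f : F) : Prop := ddt F f = 0.
Definition function_of_t (K : fieldType) (lam : K) (F : function_class lam)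
    (f : F) : Prop := ddx F f = 0.

Definition periodic_null_mode (K : fieldType) (lam : K)
    (F : function_class lam) (h : F) : Prop :=
  [/\ function_of_t h, shift F h = h & ~ exists k : K, h = k%:A].

(* The algebra A, [x,t] = lam x, on functions of class F.  [nord f] is the
   element of A with normal-ordered symbol f, t to the right, so that
   nord (f(x) g(x,t) h(t)) = f(x) g(x,t) h(t) in A.  By the latter, the
   relations [f(x),t] = lam x f'(x) and h(t) x = x h(t - lam) take, on a
   general f(x,t), the form of [nord_t] and [nord_x]. *)
Record normal_ordered_algebra (K : fieldType) (lam : K)
    (F : function_class lam) := NormalOrderedAlgebra {
  noa :> algType K;
  nord : {linear F -> noa};
  symb : noa -> F;
  nordK : cancel nord symb;
  symbK : cancel symb nord;
  nord_left : forall f g : F,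
    function_of_x f -> nord (f * g) = nord f * nord g;
  nord_right : forall g h : F,
    function_of_t h -> nord (g * h) = nord g * nord h;
  nord_t : forall f,
    nord f * nord (ft F) - nord (ft F) * nord f
      = lam *: (nord (fx F) * nord (ddx F f));
  nord_x : forall f, nord f * nord (fx F) = nord (fx F) * nord (shift F f)
}.

Section Calculus.
Variables (K : fieldType) (lam : K) (F : function_class lam).
Variable A : normal_ordered_algebra F.
Implicit Types (f g : A).

Definition gen_x : A := nord A (fx F).
Definition gen_t : A := nord A (ft F).

Definition op_ddx f : A := nord A (ddx F (symb f)).
Definition op_shift f : A := nord A (shift F (symb f)).

(* Omega^1 is free as a left A-module: the row (a, b) stands for a dx + b dt. *)
Definition Omega1 := 'rV[A]_2.
Definition ix : 'I_2 := ord0.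
Definition it : 'I_2 := ord_max.
Definition dx : Omega1 := delta_mx 0 ix.
Definition dt : Omega1 := delta_mx 0 it.

(* The right action.  By the relations, dx is central,
   dt f(x) = f(x) dt - lam f'(x) dx  and  dt h(t) = h(t - lam) dt,  hence
   dt f = f(x, t - lam) dt - lam (d f/d x) dx  on normal-ordered f(x,t). *)
Definition ract (w : Omega1) f : Omega1 :=
  (w 0 ix * f - lam *: (w 0 it * op_ddx f)) *: dx + (w 0 it * op_shift f) *: dt.

(* Omega^1 (x)_A Omega^1 is free as a left A-module on the e_i (x) e_j, with
   (e_0, e_1) = (dx, dt): the matrix g stands for \sum_(i, j) g i j e_i (x) e_j.
   Since u (x) (v_0 dx + v_1 dt) = (u v_0) (x) dx + (u v_1) (x) dt, the
   coefficients of u (x) v are as follows. *)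
Definition Omega1_2 := 'M[A]_2.
Definition tens (u v : Omega1) : Omega1_2 :=
  \matrix_(i, j) ract u (v 0 j) 0 i.

Definition ract2 (g : Omega1_2) f : Omega1_2 :=
  \sum_i \sum_j g i j *: tens (delta_mx 0 i) (ract (delta_mx 0 j) f).

Definition central (g : Omega1_2) : Prop := forall f, f *: g = ract2 g f.

(* The coefficient of dx /\ dt in /\(g), for dx, dt anticommuting and of
   square zero. *)
Definition wedge (g : Omega1_2) : A := g ix it - g it ix.
Definition quantum_symmetric (g : Omega1_2) : Prop := wedge g = 0.

Definition metric (a b c : A) : Omega1_2 :=
  a *: tens dx dx + b *: (tens dx dt + tens dt dx) + c *: tens dt dt.

Definition g_family (alpha beta : K) : Omega1_2 :=
  metric (gen_t ^+ 2 + (2%:R * beta) *: gen_t + lam *: gen_t + alpha%:A)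
         (- (gen_x * (gen_t + beta%:A)))
         (gen_x ^+ 2).

Definition g_deg (alpha : K) : Omega1_2 :=
  metric (alpha%:A - 2%:R *: gen_t) gen_x 0.

(* Consistency of the above: [x,t] = lam x holds, [ract] is a right action
   with the defining relations of Omega^1, and [tens] is balanced over A and
   compatible with [ract2]. *)

Lemma ddx1 : ddx F 1 = 0.
Proof.
have := ddx_mul (1 : F) 1; rewrite !mulr1 mul1r.
by move/(congr1 (fun u => u - ddx F 1)); rewrite addrK subrr.
Qed.

Lemma nord1 : nord A 1 = 1.
Proof.
have h1 : function_of_t (1 : F) by exact: ddx1.
by have := nord_right A (symb (1 : A)) h1; rewrite mulr1 symbK mul1r.
Qed.

Lemma gen_comm : gen_x * gen_t - gen_t * gen_x = lam *: gen_x.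
Proof. by rewrite nord_t ddx_x nord1 mulr1. Qed.

Lemma comm_x f : f * gen_x = gen_x * op_shift f.
Proof. by rewrite -{1}[f]symbK nord_x. Qed.

Lemma comm_t f : f * gen_t - gen_t * f = lam *: (gen_x * op_ddx f).
Proof. by rewrite -{1 2}[f]symbK nord_t. Qed.

Lemma gen_xI : injective (fun f => gen_x * f).
Proof.
move=> f g /= /eqP; rewrite -subr_eq0 -mulrBr -[f - g]symbK.
rewrite -nord_left; last exact: ddt_x.
rewrite -[0](raddf0 (nord A)) (can_eq (@nordK _ _ _ A)) => /eqP/fx_regular.
by move/(congr1 (nord A)); rewrite symbK raddf0 => /eqP; rewrite subr_eq0 => /eqP.
Qed.

Lemma op_shiftM f g : op_shift (f * g) = op_shift f * op_shift g.
Proof.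
by apply: gen_xI; rewrite /= mulrA -!comm_x -!mulrA (comm_x g).
Qed.

Lemma symbE u : symb (nord A u) = u. Proof. exact: nordK. Qed.

Lemma op_shift_x : op_shift gen_x = gen_x.
Proof. by rewrite /op_shift symbE shift_x. Qed.
Lemma op_shift_t : op_shift gen_t = gen_t - lam%:A.
Proof. by rewrite /op_shift symbE shift_t raddfB /= linearZ /= nord1. Qed.
Lemma op_ddx_x : op_ddx gen_x = 1.
Proof. by rewrite /op_ddx symbE ddx_x nord1. Qed.
Lemma op_ddx_t : op_ddx gen_t = 0.
Proof. by rewrite /op_ddx symbE ddx_t raddf0. Qed.

Lemma symbD f g : symb (f + g) = symb f + symb g.
Proof. by apply: (can_inj (@nordK _ _ _ A)); rewrite raddfD /= !symbK. Qed.
Lemma symbZ (k : K) f : symb (k *: f) = k *: symb f.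
Proof. by apply: (can_inj (@nordK _ _ _ A)); rewrite linearZ /= !symbK. Qed.
Lemma op_shiftD f g : op_shift (f + g) = op_shift f + op_shift g.
Proof. by rewrite /op_shift symbD !raddfD. Qed.
Lemma op_shiftZ (k : K) f : op_shift (k *: f) = k *: op_shift f.
Proof. by rewrite /op_shift symbZ linearZ /= linearZ. Qed.
Lemma op_ddxD f g : op_ddx (f + g) = op_ddx f + op_ddx g.
Proof. by rewrite /op_ddx symbD !raddfD. Qed.
Lemma op_ddxZ (k : K) f : op_ddx (k *: f) = k *: op_ddx f.
Proof. by rewrite /op_ddx symbZ linearZ /= linearZ. Qed.

Hypothesis lam0 : lam != 0.

Lemma op_ddxM f g : op_ddx (f * g) = op_ddx f * g + op_shift f * op_ddx g.
Proof.
apply: gen_xI => /=; apply: (scalerI lam0); rewrite -comm_t.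
rewrite mulrDr scalerDr (mulrA _ (op_ddx f)) scalerAl -comm_t.
rewrite (mulrA _ (op_shift f)) -comm_x -(mulrA f gen_x) scalerAr -comm_t.
by rewrite mulrBr mulrBl !mulrA [RHS]addrC addrA subrK.
Qed.

Lemma ractE w f :
  (ract w f 0 ix = w 0 ix * f - lam *: (w 0 it * op_ddx f)) *
  (ract w f 0 it = w 0 it * op_shift f).
Proof. by rewrite !mxE /= !(mulr0, mulr1, addr0, add0r). Qed.

Lemma row2P (u v : Omega1) : u 0 ix = v 0 ix -> u 0 it = v 0 it -> u = v.
Proof.
move=> h0 h1; apply/rowP=> j; case: (unliftP it j) => [k ->|-> //].
by rewrite (_ : lift it k = ix) //; apply: val_inj; case: k => [[]].
Qed.

Lemma ractA w f g : ract w (f * g) = ract (ract w f) g.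
Proof.
apply: row2P; rewrite !ractE; last by rewrite op_shiftM mulrA.
rewrite op_ddxM mulrBl mulrDr scalerDr opprD addrA -scalerAl.
by rewrite !mulrA.
Qed.

Lemma ractZ a w f : ract (a *: w) f = a *: ract w f.
Proof.
apply: row2P; rewrite [in RHS]mxE !ractE ![(a *: w) _ _]mxE ?mulrA //.
by rewrite mulrBr -scalerAr !mulrA.
Qed.

Lemma ractDl v w f : ract (v + w) f = ract v f + ract w f.
Proof.
apply: row2P; rewrite [in RHS]mxE !ractE !mxE ?mulrDl //.
by rewrite scalerDr opprD addrACA.
Qed.

Lemma ractDr w f g : ract w (f + g) = ract w f + ract w g.
Proof.
apply: row2P; rewrite [in RHS]mxE !ractE ?op_shiftD ?op_ddxD !mulrDr //.
by rewrite scalerDr opprD addrACA.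
Qed.

Lemma op_shift1 : op_shift 1 = 1.
Proof. by rewrite /op_shift -nord1 symbE rmorph1. Qed.

Lemma ract1 w : ract w 1 = w.
Proof.
apply: row2P; rewrite !ractE ?op_shift1 !mulr1 //.
by rewrite /op_ddx -nord1 symbE ddx1 raddf0 mulr0 scaler0 subr0.
Qed.

Lemma dxE : ((dx 0 ix = 1) * (dx 0 it = 0)) * ((dt 0 ix = 0) * (dt 0 it = 1)).
Proof. by rewrite !mxE. Qed.

Lemma dx_x : ract dx gen_x = gen_x *: dx.
Proof.
apply: row2P; rewrite !ractE [RHS]mxE !dxE !mul0r ?mulr0 //.
by rewrite scaler0 subr0 mul1r mulr1.
Qed.

Lemma dx_t : ract dx gen_t = gen_t *: dx.
Proof.
apply: row2P; rewrite !ractE [RHS]mxE !dxE !mul0r ?mulr0 //.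
by rewrite scaler0 subr0 mul1r mulr1.
Qed.

Lemma dt_x : gen_x *: dt - ract dt gen_x = lam%:A *: dx.
Proof.
apply: row2P; rewrite !(ractE, mxE) /= ?mulr0 ?mulr1 ?mul1r ?mul0r.
  by rewrite op_ddx_x !sub0r opprK.
by rewrite op_shift_x subrr.
Qed.

Lemma dt_t : gen_t *: dt - ract dt gen_t = lam%:A *: dt.
Proof.
apply: row2P; rewrite !(ractE, mxE) /= ?mulr0 ?mulr1 ?mul1r ?mul0r.
  by rewrite op_ddx_t scaler0 !subr0.
by rewrite op_shift_t opprB addrC subrK.
Qed.

Lemma tens_balanced u v f : tens (ract u f) v = tens u (f *: v).
Proof. by apply/matrixP=> i j; rewrite mxE [RHS]mxE [(f *: v) _ _]mxE ractA. Qed.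

Lemma tensDl v u w : tens (u + w) v = tens u v + tens w v.
Proof.
by apply/matrixP=> i j; rewrite mxE ractDl [RHS]mxE ![tens _ _ _ _]mxE [LHS]mxE.
Qed.

Lemma tensDr u v w : tens u (v + w) = tens u v + tens u w.
Proof.
apply/matrixP=> i j; rewrite mxE [(v + w) _ _]mxE ractDr.
by rewrite [RHS]mxE ![tens _ _ _ _]mxE [LHS]mxE.
Qed.

Lemma tensZl f u v : tens (f *: u) v = f *: tens u v.
Proof.
by apply/matrixP=> i j; rewrite mxE ractZ [RHS]mxE [tens _ _ _ _]mxE [LHS]mxE.
Qed.

Lemma tens_ract2 u v f : ract2 (tens u v) f = tens u (ract v f).
Proof.
have t0l z : tens 0 z = 0 by apply: (addrI (tens 0 z)); rewrite -tensDl !addr0.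
have t0r z : tens z 0 = 0 by apply: (addrI (tens z 0)); rewrite -tensDr !addr0.
have r0 : ract 0 f = 0 by apply: (addrI (ract 0 f)); rewrite -ractDl !addr0.
rewrite {2}[v]row_sum_delta (big_morph (ract^~ f) (fun u v => ractDl u v f) r0).
rewrite (big_morph (tens u) (tensDr u) (t0r u)) /ract2 exchange_big /=.
apply: eq_bigr => j _; rewrite ractZ -tens_balanced.
rewrite [in RHS](row_sum_delta (ract u _)).
rewrite (big_morph (tens^~ _) (tensDl _) (t0l _)).
by apply: eq_bigr => i _; rewrite tensZl mxE.
Qed.

End Calculus.

Arguments dx {K lam F A}.
Arguments dt {K lam F A}.

(* Main.v *)
(* Write sigma for the shift t |-> t - lam and ' for d/dx.  For a metric with
   coefficients a, b, c, centrality says that for all f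
     f c = c sigma^2(f),   f b = b sigma(f) - lam c sigma(f'),
     f a = a f - 2 lam b f' + lam^2 c f''.
   Taking f = x and f = t and passing to normal-ordered symbols gives
     sigma c = c,                  x c' = 2 c,
     x (sigma b - b) = lam c,      x b' = b,
     x (sigma a - a) = 2 lam b,    a' = 0.
   Since x can be cancelled, c'', b' and a are functions of t.  In the absence
   of periodic null modes a shift-invariant function of t is a constant, so these
   difference equations are solved successively by c = gam x^2,
   b = x (kap - gam t), a = gam (t^2 + lam t) - 2 kap t + alp.  All these
   solutions are central: this is linear in (gam, kap, alp). *)
Require Import Defs.
From mathcomp Require Import all_boot all_order all_algebra.
From mathcomp Require Import reals complex boolp ring.
Set Implicit Arguments.
Unset Strict Implicit.
Unset Printing Implicit Defensive.
Import GRing.Theory Num.Theory.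
Local Open Scope ring_scope.
Local Open Scope complex_scope.

(** * Centrality as a system of equations on the three coefficients *)

Section Metrics.
Variables (K : fieldType) (lam : K) (F : function_class lam).
Variable A : normal_ordered_algebra F.
Implicit Types (a b c f : A) (u v h : F).

Lemma ord2P (P : 'I_2 -> Prop) : P ix -> P it -> forall i, P i.
Proof.
move=> Px Pt i; case: (unliftP it i) => [k ->|-> //].
by rewrite (_ : lift it k = ix) //; apply: val_inj; case: k => [[]].
Qed.

Lemma sum_ord2 (V : nmodType) (G : 'I_2 -> V) : \sum_i G i = G ix + G it.
Proof.
rewrite big_ord_recl big_ord1; congr (_ + G _).
by apply: val_inj.
Qed.

Lemma op_ddx_shift f : op_ddx (op_shift f) = op_shift (op_ddx f).
Proof. by rewrite /op_ddx /op_shift !symbE shift_ddx. Qed.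

Lemma op_ddx0 : op_ddx (0 : A) = 0.
Proof. by have := op_ddxZ 0 (0 : A); rewrite !scale0r. Qed.
Lemma op_shift0 : op_shift (0 : A) = 0.
Proof. by have := op_shiftZ 0 (0 : A); rewrite !scale0r. Qed.
Lemma op_ddx1 : op_ddx (1 : A) = 0.
Proof. by rewrite /op_ddx -nord1 symbE ddx1 raddf0. Qed.

Lemma metricE a b c :
  ((metric a b c ix ix = a) * (metric a b c ix it = b)) *
  ((metric a b c it ix = b) * (metric a b c it it = c)).
Proof.
by split; split; rewrite !(mxE, ractE, dxE) ?(op_ddx0, op_ddx1, op_shift0, op_shift1);
  rewrite ?(mulr0, mul0r, mulr1, scaler0, addr0, add0r, oppr0).
Qed.

Lemma quantum_symmetricP (g : Omega1_2 A) :
  quantum_symmetric g -> g = metric (g ix ix) (g ix it) (g it it).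
Proof.
move=> /subr0_eq gS; apply/matrixP; apply: ord2P; apply: ord2P;
  by rewrite metricE.
Qed.

Lemma metric_quantum_symmetric a b c : quantum_symmetric (metric a b c).
Proof. by rewrite /quantum_symmetric /wedge !metricE subrr. Qed.

Lemma scale_metric f a b c : f *: metric a b c = metric (f * a) (f * b) (f * c).
Proof.
by apply/matrixP; apply: ord2P; apply: ord2P; rewrite mxE !metricE.
Qed.

(** Each [dt] that [f] crosses shifts it and emits [- lam] times its x-derivative on [dx]. As
    [op_ddx] commutes with [op_shift], the two mixed entries give the same equation. *)
Lemma central_metricP a b c :
  central (metric a b c) <-> forall f,
    [/\ f * c = c * op_shift (op_shift f),
        f * b = b * op_shift f - lam *: (c * op_shift (op_ddx f))
      & f * a = a * f - (2%:R * lam) *: (b * op_ddx f)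
                + (lam ^+ 2) *: (c * op_ddx (op_ddx f))].
Proof.
have E f : ract2 (metric a b c) f = metric
    (a * f - (2%:R * lam) *: (b * op_ddx f)
       + (lam ^+ 2) *: (c * op_ddx (op_ddx f)))
    (b * op_shift f - lam *: (c * op_shift (op_ddx f)))
    (c * op_shift (op_shift f)).
  rewrite /ract2 sum_ord2 !sum_ord2 !metricE; apply/matrixP.
  have dE : ((delta_mx 0 ix : Omega1 A) = dx) * ((delta_mx 0 it : Omega1 A) = dt).
    by split.
  apply: ord2P; apply: ord2P; rewrite metricE !dE !(mxE, ractE, dxE);
    rewrite ?(mul0r, mul1r, mulr0, scaler0, subr0, sub0r);
    rewrite -?scaleNr ?(op_ddx0, op_shift0, op_ddxZ, op_shiftZ, op_ddx_shift);
    rewrite ?(mulr0, scaler0, addr0, add0r, oppr0) -?scalerAr ?scalerA //.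
  rewrite mulrNN -expr2 addrA; congr (_ + _).
  by rewrite -addrA -scalerDl -mulr2n mulNrn mulr_natl.
split=> [ctr f|ctr f].
  have /matrixP gE := etrans (esym (scale_metric f a b c)) (etrans (ctr f) (E f)).
  by have := (gE ix ix, gE ix it, gE it it); rewrite !metricE => -[[]].
by rewrite E scale_metric; case: (ctr f) => -> -> ->.
Qed.

Lemma symb_mulx f : symb (gen_x A * f) = fx F * symb f.
Proof.
apply: (can_inj (@nordK _ _ _ A)); rewrite symbK nord_left ?symbK //.
exact: ddt_x.
Qed.

Hypothesis lam0 : lam != 0.

(** Centrality at [gen_t], compared with [comm_t], gives the x-derivatives; centrality at [gen_x],
    compared with [comm_x], gives the shifts. *)
Lemma central_system a b c (u := symb a) (v := symb b) (w := symb c) :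
  central (metric a b c) ->
  [/\ (fx F * ddx F w = 2%:R *: w) /\ (shift F w = w),
      (fx F * ddx F v = v) /\ (fx F * v = fx F * shift F v - lam *: w)
    & (ddx F u = 0) /\ (fx F * u = fx F * shift F u - (2%:R * lam) *: v)].
Proof.
move/central_metricP=> cE.
have sop f : symb (op_shift f) = shift F (symb f) by rewrite symbE.
have dop f : symb (op_ddx f) = ddx F (symb f) by rewrite symbE.
have symbB f g : symb (f - g) = symb f - symb g.
  by rewrite -scaleN1r symbD symbZ scaleN1r.
have [cx bx ax] := cE (gen_x A); have [ct bt at_] := cE (gen_t A).
rewrite !(op_ddx_x, op_shift_x, op_ddx1, op_shift1) in cx bx ax.
rewrite !(mulr1, mulr0, scaler0, addr0) in cx bx ax.
have sst : op_shift (op_shift (gen_t A)) = gen_t A - (2%:R * lam)%:A.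
  rewrite op_shift_t -scaleNr op_shiftD op_shiftZ op_shift_t op_shift1.
  by rewrite -addrA -scaleNr -scalerDl -mulr2n mulNrn mulr_natl scaleNr.
rewrite !(sst, op_shift_t, op_ddx_t, op_ddx0, op_shift0) in ct bt at_.
rewrite !(mulr0, scaler0, addr0, subr0) in ct bt at_.
split; split.
- rewrite -dop -symb_mulx -symbZ; congr symb; apply: (scalerI lam0).
  by rewrite -comm_t ct mulrBr mulr_algr opprB addrCA subrr addr0 scalerA mulrC.
- by rewrite -sop; congr symb; apply: gen_xI; rewrite /= cx comm_x.
- rewrite -dop -symb_mulx; congr symb; apply: (scalerI lam0).
  by rewrite -comm_t bt mulrBr mulr_algr opprB addrCA subrr addr0.
- by rewrite -sop -!symb_mulx -symbZ -symbB bx comm_x.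
- apply: (can_inj (@nordK _ _ _ A)); rewrite raddf0.
  apply: gen_xI; apply: (scalerI lam0); rewrite /= mulr0 scaler0.
  by rewrite (_ : nord A _ = op_ddx a) // -comm_t at_ subrr.
- by rewrite -sop -!symb_mulx -symbZ -symbB ax comm_x.
Qed.

End Metrics.

(** * Solution of the differential and difference equations *)

Lemma solve_system (K : fieldType) (lam : K) (F : function_class lam)
    (two0 : 2%:R != 0 :> K)
    (no_null_modes : forall h : F, ~ periodic_null_mode h) (u v w : F) :
  fx F * ddx F w = 2%:R *: w -> shift F w = w ->
  fx F * ddx F v = v -> fx F * v = fx F * shift F v - lam *: w ->
  ddx F u = 0 -> fx F * u = fx F * shift F u - (2%:R * lam) *: v ->
  exists gam kap alp : K,
    [/\ w = gam *: fx F ^+ 2, v = kap *: fx F - gam *: (fx F * ft F)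
      & u = gam *: (ft F ^+ 2 + lam *: ft F) - (2%:R * kap) *: ft F + alp%:A].
Proof.
move=> dw sw dv sv du su.
(* Excluded middle turns the absence of null modes into an explicit scalar. *)
have const (h : F) : ddx F h = 0 -> shift F h = h -> exists k, h = k%:A.
  by move=> dh sh; apply: contrapT => nk; apply: (no_null_modes h); split.
have xI (f g : F) : fx F * f = fx F * g -> f = g.
  by move=> /eqP; rewrite -subr_eq0 -mulrBr => /eqP/fx_regular/subr0_eq.
have ddx_xM (f : F) : ddx F (fx F * f) = f + fx F * ddx F f.
  by rewrite ddx_mul ddx_x mul1r.
(* Differentiating [x w' = 2 w] twice and cancelling x makes w'' a function of
   t, and w'' inherits the invariance of w under the shift. *)
have d2w : fx F * ddx F (ddx F w) = ddx F w.
  apply: (addrI (ddx F w)); rewrite -ddx_xM dw linearZ /=.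
  by rewrite scaler_nat mulr2n.
have d3w : ddx F (ddx F (ddx F w)) = 0.
  apply: (@fx_regular _ _ F); apply: (addrI (ddx F (ddx F w))).
  by rewrite -ddx_xM d2w addr0.
have [k wk] : exists k, ddx F (ddx F w) = k%:A.
  by apply: const => //; rewrite !shift_ddx sw.
(* From [2 w = x w' = x (x w'') = k x^2]. *)
pose gam := k / 2%:R.
have {dw}wE : w = gam *: fx F ^+ 2.
  apply: (scalerI two0); rewrite -dw -d2w wk scalerA /gam (mulrC 2%:R) divfK //.
  by rewrite !mulr_algr -scalerAr.
have d2v : ddx F (ddx F v) = 0.
  apply: (@fx_regular _ _ F); apply: (addrI (ddx F v)).
  by rewrite -ddx_xM dv addr0.
set p := ddx F v in dv d2v.
(* Since [v = x p] and [w = gam x^2], the shift equation for [v], multiplied by [x], has a common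
   factor [x^2] to cancel. *)
have sp : shift F p = p + (lam * gam)%:A.
  apply: (xI); apply: (xI).
  rewrite mulrDr dv mulrDr sv -dv rmorphM /= shift_x wE.
  by rewrite mulr_algr -!scalerAr -expr2 scalerA subrK.
(* The shift lowers [gam t] by [lam gam], which offsets the change in [p]. *)
have [kap hE] : exists kap, p + gam *: ft F = kap%:A.
  apply: const; first by rewrite raddfD /= d2v linearZ /= ddx_t scaler0 addr0.
  rewrite raddfD /= sp linearZ /= shift_t scalerBr scalerA -addrA; congr (_ + _).
  by rewrite addrC mulrC subrK.
have pE : p = kap%:A - gam *: ft F by rewrite -hE addrK.
have {}su : u = shift F u - (2%:R * lam) *: p.
  by apply: xI; rewrite mulrBr -scalerAr dv.
(* The terms removed from [u] form a particular solution; [lam t] absorbs the [lam^2] created by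
   shifting [t^2]. *)
have [alp aE] : exists alp,
    u - gam *: (ft F ^+ 2 + lam *: ft F) + (2%:R * kap) *: ft F = alp%:A.
  apply: const.
    rewrite raddfD raddfB /= !linearZ /= raddfD /= linearZ /= expr2 ddx_mul.
    by rewrite du ddx_t !(mulr0, mul0r, scaler0, addr0, oppr0).
  rewrite {2}su pE.
  rewrite raddfD raddfB /= !linearZ /= raddfD /= linearZ /= rmorphXn /= shift_t.
  (* Scalars become ring elements so that [ring] applies. *)
  have zE k' (f : F) : k' *: f = in_alg F k' * f by rewrite mulr_algl.
  by rewrite !zE; ring.
exists gam, kap, alp; split=> //; last by rewrite -aE addrACA addNr addr0 addrC subrK.
by rewrite -dv pE mulrBr mulr_algr -scalerAr.
Qed.

(** * The linear three-parameter family: centrality, exhaustiveness, injectivity *)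

Section Family.
Variables (K : fieldType) (lam : K) (F : function_class lam).
Variable A : normal_ordered_algebra F.
Implicit Types (f : A) (g h : Omega1_2 A) (k gam kap alp : K).
Local Notation X := (gen_x A).
Local Notation T := (gen_t A).

(* The three parameters enter linearly: (1, - beta, alpha) gives g_family,
   (0, 1, alpha) gives g_deg and (0, 0, 1) gives dx (x) dx. *)
Definition central_metric gam kap alp : Omega1_2 A :=
  metric (gam *: (T ^+ 2 + lam *: T) - (2%:R * kap) *: T + alp%:A)
         (kap *: X - gam *: (X * T))
         (gam *: X ^+ 2).

Lemma nord_monomials :
  [/\ nord A (fx F ^+ 2) = X ^+ 2, nord A (fx F * ft F) = X * T
    & nord A (ft F ^+ 2) = T ^+ 2].
Proof.
have fX : function_of_x (fx F) by exact: ddt_x.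
have fT : function_of_t (ft F) by exact: ddx_t.
by split; [rewrite expr2 nord_left | rewrite nord_left | rewrite expr2 nord_right].
Qed.

Lemma metricD a b c a' b' c' :
  metric a b c + metric a' b' c' = metric (a + a') (b + b') (c + c') :> Omega1_2 A.
Proof.
by apply/matrixP; apply: ord2P; apply: ord2P; rewrite mxE !metricE.
Qed.

Lemma centralD g h : central g -> central h -> central (g + h).
Proof.
move=> gc hc f; rewrite scalerDr gc hc /ract2 -big_split /=.
apply: eq_bigr => i _; rewrite -big_split /=; apply: eq_bigr => j _.
by rewrite -scalerDl mxE.
Qed.

Lemma centralZ k g : central g -> central (k%:A *: g).
Proof.
move=> gc f.
rewrite (_ : f *: _ = k%:A *: (f *: g)); last first.
  by rewrite !scalerA mulr_algr mulr_algl.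
rewrite gc /ract2 scaler_sumr; apply: eq_bigr => i _.
by rewrite scaler_sumr; apply: eq_bigr => j _; rewrite scalerA mxE.
Qed.

Lemma scale_central_metric k gam kap alp :
  k%:A *: central_metric gam kap alp
    = central_metric (k * gam) (k * kap) (k * alp).
Proof.
rewrite scale_metric !mulr_algl; congr metric; rewrite ?scalerA //.
  by rewrite scalerDr scalerBr !scalerA mulrCA.
by rewrite scalerBr !scalerA.
Qed.

Lemma g_familyE (alp bet : K) : g_family A alp bet = central_metric 1 (- bet) alp.
Proof.
congr metric; rewrite !scale1r //.
  by rewrite mulrN scaleNr opprK -!addrA; congr (_ + _); rewrite addrCA.
by rewrite scaleNr -opprD mulrDr mulr_algr addrC.
Qed.

Lemma g_degE alp : g_deg A alp = central_metric 0 1 alp.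
Proof.
by congr metric; rewrite !scale0r ?mulr1 ?scale1r ?subr0 // sub0r addrC.
Qed.

Lemma dxdxE : tens dx dx = central_metric 0 0 1.
Proof.
rewrite /central_metric mulr0 !scale0r !subr0 add0r scale1r /metric.
by rewrite !scale0r !addr0 scale1r.
Qed.

(** By linearity three basis metrics suffice; for each, [f] is moved to the right past [X] and
    [T]. *)
Lemma central_metric_central (lam0 : lam != 0) gam kap alp :
  central (central_metric gam kap alp).
Proof.
have fX f : f * X = X * op_shift f by exact: comm_x.
have fT f : f * T = T * f + lam *: (X * op_ddx f).
  by apply/eqP; rewrite addrC -subr_eq comm_t.
have TX : T * X = X * T - lam *: X.
  by rewrite fX op_shift_t mulrBr mulr_algr.
have -> : central_metric gam kap alp =
    gam%:A *: central_metric 1 0 0 + kap%:A *: central_metric 0 1 0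
      + alp%:A *: tens dx dx.
  rewrite dxdxE !scale_central_metric !metricD; congr metric;
    rewrite ?(mulr0, mulr1, scale0r, subr0, sub0r, addr0, add0r, oppr0) //.
  by rewrite addrC.
apply: centralD; first apply: centralD.
- apply: centralZ; apply/central_metricP => f; rewrite mulr0 !scale0r !scale1r.
  rewrite addr0 subr0 sub0r.
  split.
  + by rewrite !expr2 mulrA (fX f) -mulrA (fX (op_shift f)) mulrA.
  + rewrite mulrN mulrA (fX f) -mulrA (fT (op_shift f)) mulrDr -scalerAr opprD mulNr !mulrA.
    by rewrite op_ddx_shift expr2.
  + have fTT : f * T ^+ 2 = T ^+ 2 * f + lam *: (T * X * op_ddx f)
        + (lam *: (X * T * op_ddx f) + lam ^+ 2 *: (X ^+ 2 * op_ddx (op_ddx f))).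
      rewrite !expr2 mulrA (fT f) mulrDl -mulrA (fT f) -scalerAl.
      rewrite -(mulrA X (op_ddx f)) (fT (op_ddx f)).
      by rewrite !mulrDr -!scalerAr scalerDr !mulrA scalerA.
    (* Reordering [T * X] leaves [- lam^2 X f'], which the [lam T] term of the coefficient cancels
       ([S] below). *)
    rewrite mulrDr fTT -scalerAr (fT f) TX mulrBl mulrDl !scalerDr scalerN -!scalerAl.
    rewrite mulNr scalerN opprK mulr_natl mulr2n scalerDl !addrA.
    move: (T ^+ 2 * f) (lam *: (X * T * _)) (lam *: (lam *: _)) => P Q S.
    move: (lam ^+ 2 *: _) (lam *: _) => W U.
    rewrite (addrAC _ (- S) Q) (addrAC _ (- S) W) (addrAC _ (- S) U) subrK.
    by rewrite (addrAC _ W U) !(addrAC _ Q U).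
- apply: centralZ; apply/central_metricP => f; rewrite mulr1 !scale0r scale1r.
  rewrite addr0 subr0 sub0r !mul0r scaler0 subr0; split=> //.
    by rewrite mulr0.
  by rewrite scaler0 addr0 mulrN mulNr -scalerAr fT scalerDr opprD -scalerAl
             scalerA.
- apply: centralZ; rewrite dxdxE; apply/central_metricP => f.
  rewrite mulr0 !scale0r scale1r !subr0 add0r.
  by rewrite !(mulr0, mul0r, scaler0, subr0, addr0) mulr1 mul1r.
Qed.

Hypotheses (lam0 : lam != 0) (two0 : 2%:R != 0 :> K).
Hypothesis no_null_modes : forall h : F, ~ periodic_null_mode h.

Lemma central_metric_exhaustive g : quantum_symmetric g -> central g ->
  exists gam kap alp, g = central_metric gam kap alp.
Proof.
move=> /quantum_symmetricP -> /(central_system lam0) [[dw sw] [dv sv] [du su]].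
have [gam [kap [alp [cE bE aE]]]] :=
  solve_system two0 no_null_modes dw sw dv sv du su.
exists gam, kap, alp; have [x2 xt t2] := nord_monomials; congr metric.
- rewrite -[LHS]symbK aE raddfD raddfB /= linearZ /= raddfD /= t2.
  by do 4![rewrite linearZ /=]; rewrite nord1.
- by rewrite -[LHS]symbK bE raddfB /= linearZ /= linearZ /= xt.
- by rewrite -[LHS]symbK cE linearZ /= x2.
Qed.

(** Cancelling [X] twice would give [1 = 0] in [A]. *)
Lemma gen_x_sqr_neq0 : X ^+ 2 != 0 :> A.
Proof.
apply/eqP; rewrite expr2 => XX0; have /eqP := oner_neq0 A; apply.
have gX0 f : X * f = 0 -> f = 0.
  by move=> Xf0; apply: gen_xI; rewrite /= Xf0 mulr0.
by apply: (gX0); rewrite mulr1; apply: (gX0).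
Qed.

Lemma scalar_inj (k l : K) : k%:A = l%:A :> A -> k = l.
Proof. exact: (fmorph_inj (in_alg A)). Qed.

(** The entries are triangular in the parameters: [gam], then [kap], then [alp] are read off. *)
Lemma central_metric_inj gam kap alp gam' kap' alp' :
  central_metric gam kap alp = central_metric gam' kap' alp' ->
  [/\ gam = gam', kap = kap' & alp = alp'].
Proof.
move=> /matrixP gE; have := (gE it it, gE ix it, gE ix ix).
rewrite !metricE => -[[cE bE] aE].
have gam_eq : gam = gam'.
  apply/eqP; move/eqP: cE; rewrite -subr_eq0 -scalerBl scaler_eq0.
  by rewrite (negPf gen_x_sqr_neq0) orbF subr_eq0.
rewrite gam_eq in bE aE.
have kap_eq : kap = kap'.
  apply: scalar_inj; apply: gen_xI; rewrite /= !mulr_algr.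
  exact: addIr bE.
rewrite kap_eq in aE.
by split=> //; apply: scalar_inj; exact: addrI aE.
Qed.

End Family.

Theorem proposition2p2 (R : realType) (lam : R[i])
    (lam_im : complex.Re lam = 0) (lam0 : lam != 0)
    (F : function_class lam)
    (no_null_modes : forall h : F, ~ periodic_null_mode h)
    (A : normal_ordered_algebra F) :
  [/\ (* the family and the degenerate cases are central, quantum symmetric *)
      (forall alpha beta : R[i],
         quantum_symmetric (g_family A alpha beta) /\
         central (g_family A alpha beta)),
      (forall alpha : R[i],
         quantum_symmetric (g_deg A alpha) /\ central (g_deg A alpha)) /\
      (quantum_symmetric (@tens _ _ _ A dx dx) /\
       central (@tens _ _ _ A dx dx)),
      (* the parameters are determined by the metric up to normalisation *)
      (forall mu alpha beta alpha' beta' : R[i],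
         g_family A alpha beta = mu%:A *: g_family A alpha' beta' ->
         alpha = alpha' /\ beta = beta'),
      (* there are no others with nonzero coefficient of dt (x) dt *)
      (forall g : Omega1_2 A, quantum_symmetric g -> central g ->
         g it it != 0 ->
         exists mu alpha beta : R[i],
           mu != 0 /\ g = mu%:A *: g_family A alpha beta)
    & (* and, with vanishing coefficient of dt (x) dt, only the degenerate *)
      (forall g : Omega1_2 A, quantum_symmetric g -> central g ->
         g it it = 0 -> g != 0 ->
         exists mu : R[i], mu != 0 /\
           ((exists alpha : R[i], g = mu%:A *: g_deg A alpha) \/
            g = mu%:A *: tens dx dx))].
Proof.
have two0 : 2%:R != 0 :> R[i] by rewrite pnatr_eq0.
have qs gam kap alp : quantum_symmetric (central_metric A gam kap alp).
  exact: metric_quantum_symmetric.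
have ctr gam kap alp : central (central_metric A gam kap alp).
  exact: central_metric_central.
split.
- by move=> alpha beta; rewrite g_familyE.
- by split; [move=> alpha; rewrite g_degE | rewrite dxdxE].
- move=> mu alpha beta alpha' beta'.
  rewrite !g_familyE scale_central_metric => /central_metric_inj[].
  (* The leading parameter is 1 on both sides, which forces [mu = 1]. *)
  rewrite mulr1 => <-; rewrite !mul1r => beta_eq alpha_eq.
  by split=> //; apply: oppr_inj.
- move=> g gS gC.
  have [gam [kap [alp ->]]] :=
    central_metric_exhaustive lam0 two0 no_null_modes gS gC.
  rewrite metricE scaler_eq0 negb_or => /andP[gam0 _].
  (* Dividing by [gam] makes the leading parameter 1; [g_family] has [kap = - beta]. *)
  exists gam, (alp / gam), (- (kap / gam)); split=> //.
  by rewrite g_familyE scale_central_metric opprK mulr1 !(mulrC gam) !divfK.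
- move=> g gS gC.
  have [gam [kap [alp ->]]] :=
    central_metric_exhaustive lam0 two0 no_null_modes gS gC.
  rewrite metricE => /eqP.
  rewrite scaler_eq0 (negPf (gen_x_sqr_neq0 A)) orbF => /eqP-> g0.
  have [kap0 | kap0] := eqVneq kap 0.
    exists alp; split; last first.
      by right; rewrite dxdxE scale_central_metric !mulr0 mulr1 kap0.
    (* With [gam = kap = 0], a vanishing [alp] would make the metric zero. *)
    apply: contraNneq g0 => ->; rewrite kap0 -(mulr0 0) -scale_central_metric.
    by rewrite scale0r scale0r.
  exists kap; split=> //; left; exists (alp / kap).
  by rewrite g_degE scale_central_metric mulr0 mulr1 mulrC divfK.
Qed.
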